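(* Let $n\ge 1$ be an integer. (1) If $\mu\in\{-1,+1\}$, then $h=\Omega(\mu,n)$ is an involution in $\mathrm{GL}(n,\mathbb{C})$ with $h\,\mathrm{J}(\mu,n)\,h^{-1}=\mathrm{J}(\mu,n)^{-1}$. (2) If $\lambda\in\mathbb{C}\setminus\{-1,0,+1\}$ and $A=\begin{pmatrix}\mathrm{J}(\lambda,n)&0\\0&\mathrm{J}(\lambda^{-1},n)\end{pmatrix}$, then $$h=\begin{pmatrix}0&\Omega(\lambda,n)\\ \big(\Omega(\lambda,n)\big)^{-1}&0\end{pmatrix}$$ is an involution in $\mathrm{GL}(2n,\mathbb{C})$ with $hAh^{-1}=A^{-1}$.
   Context: $\mathrm{J}(\lambda,n)$ denotes the $n\times n$ Jordan block with $\lambda$ on the diagonal, $1$ on the super-diagonal and $0$ elsewhere. An involution is an element $h$ with $h^2$ equal to the identity. For non-zero $\lambda\in\mathbb{C}$, $\Omega(\lambda,n)=[x_{i,j}]_{n\times n}\in\mathrm{GL}(n,\mathbb{C})$ is the upper triangular matrix defined by: $x_{i,j}=0$ for $j<i$; $x_{n,n}=1$ and $x_{i,n}=0$ for $1\le i\le n-1$; and $x_{i,j}=-\lambda^{-1}x_{i+1,j}-\lambda^{-2}x_{i+1,j+1}$ for all $1\le i\le j\le n-1$. *)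

(* Defs.v *)
From HB Require Import structures.
From mathcomp Require Import all_boot all_order all_algebra.

Set Implicit Arguments.
Unset Strict Implicit.
Unset Printing Implicit Defensive.

Import GRing.Theory.
Local Open Scope ring_scope.

Definition jordan_block (F : fieldType) (lam : F) (n : nat) : 'M[F]_n :=
  \matrix_(i < n, j < n)
    if i == j then lam else if j == i.+1 :> nat then 1 else 0.

(* Omega_coef lam k l is the entry of Omega lam n lying k rows above the last
   row and l columns to the left of the last column, i.e. x_{n-k,n-l} in
   1-based indexing; it does not depend on n.  The guard l' <= k' says that the
   entry is on or above the diagonal. *)
Fixpoint Omega_coef (F : fieldType) (lam : F) (k l : nat) : F :=
  match k, l with
  | 0, 0 => 1
  | 0, _.+1 => 0
  | _.+1, 0 => 0
  | k'.+1, l'.+1 =>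
      if (l' <= k')%N
      then - lam^-1 * Omega_coef lam k' l'.+1 - lam ^- 2 * Omega_coef lam k' l'
      else 0
  end.

Definition Omega (F : fieldType) (lam : F) (n : nat) : 'M[F]_n :=
  \matrix_(i < n, j < n) Omega_coef lam (rev_ord i) (rev_ord j).

(* The next three lemmas are the recursive description of the entries
   x_{i,j} of Omega lam n, with 0-based indices. *)
Lemma Omega_lower (F : fieldType) (lam : F) (n : nat) (i j : 'I_n) :
  (j < i)%N -> Omega lam n i j = 0.
Proof.
move=> ltji; rewrite mxE /=.
have: (n - i.+1 < n - j.+1)%N by rewrite ltn_sub2l // (leq_ltn_trans ltji).
case: (n - i.+1)%N => [|k]; case: (n - j.+1)%N => [|l] //=.
by rewrite ltnS => ltkl; rewrite leqNgt ltkl.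
Qed.

Lemma Omega_last_col (F : fieldType) (lam : F) (n : nat) (i j : 'I_n) :
  j.+1 = n -> Omega lam n i j = (i == j)%:R.
Proof.
move=> jn; rewrite mxE /= jn subnn -val_eqE /= -eqSS jn.
have := ltn_ord i; rewrite leq_eqVlt => /orP[/eqP-> | lt_in].
  by rewrite subnn eqxx.
by rewrite ltn_eqF //; move: lt_in; rewrite -subn_gt0; case: (n - i.+1)%N.
Qed.

Lemma Omega_rec (F : fieldType) (lam : F) (n : nat) (i i' j j' : 'I_n) :
  i' = i.+1 :> nat -> j' = j.+1 :> nat -> (i <= j)%N ->
  Omega lam n i j =
    - lam^-1 * Omega lam n i' j - lam ^- 2 * Omega lam n i' j'.
Proof.
move=> ii' jj' leij; rewrite !mxE /= ii' jj'.
have lti : (i.+1 < n)%N by rewrite -ii'.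
have ltj : (j.+1 < n)%N by rewrite -jj'.
rewrite -(subnSK lti) -(subnSK ltj) /= leq_sub2l //.
Qed.

Definition involution (F : fieldType) (n : nat) (h : 'M[F]_n) : Prop :=
  h *m h = 1%:M.

(* Main.v *)
Require Import Defs.
From mathcomp Require Import all_boot all_order all_algebra.
From mathcomp Require Import reals complex.

Import GRing.Theory.
Local Open Scope ring_scope.

(** Both parts rest on two identities, valid over any field for nonzero [lam]:
      [J(lam) * Omega(lam) * J(lam^-1) = Omega(lam)]    and
      [Omega(lam) * Omega(lam^-1) = 1].

    With [J(lam) = lam + N], where [N = J(0)] is the nilpotent shift, the first
    one says that
      [lam^-1 * N Omega + lam * Omega N + N Omega N = 0];
    entrywise this is the recursion that defines [Omega(lam)]
    ([jordan_Omega_jordan]).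

    For the second one ([Omega_mulV]), put [B = Omega(lam) * Omega(lam^-1)].
    Applying the first identity to [lam] and then to [lam^-1],
      [B * J(lam) = J(lam) * Omega(lam) * J(lam^-1) * Omega(lam^-1) * J(lam)
                  = J(lam) * B].
    The last basis vector is a cyclic vector of a Jordan block, and [B] fixes it
    because both factors do; a matrix that commutes with [J(lam)] and fixes a
    cyclic vector is the identity ([commute_jordan_eq1]).

    For [mu = 1] or [mu = -1] we have [mu^-1 = mu], so that [Omega(mu)] is an
    involution and [J h J = h].  For the other values of [lam], the block
    matrix [h] is an involution whatever invertible matrix stands in the place
    of [Omega(lam)], and the two off-diagonal blocks of [A h A = h] are the first
    identity and its inverse. *)

Section JordanOmega.

Set Implicit Arguments.
Unset Strict Implicit.

Variable F : fieldType.
Implicit Types (lam : F) (n : nat).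

Lemma jordan_blockE lam n : jordan_block lam n = lam%:M + jordan_block 0 n.
Proof.
apply/matrixP => i j; rewrite !mxE.
case: (eqVneq i j) => [_|_]; first by rewrite mulr1n addr0.
by rewrite mulr0n add0r.
Qed.

Lemma shift_blockE n (i j : 'I_n) :
  jordan_block (0 : F) n i j = (j == i.+1 :> nat)%:R.
Proof.
rewrite mxE; case: (eqVneq i j) => [->|_]; first by rewrite ltn_eqF.
by case: (_ == _).
Qed.

Lemma shift_mul_succ n (X : 'M[F]_n) (i i' j : 'I_n) :
  i' = i.+1 :> nat -> (jordan_block 0 n *m X) i j = X i' j.
Proof.
move=> ii'; rewrite mxE (bigD1 i') //= shift_blockE ii' eqxx mul1r big1 ?addr0 //.
by move=> k; rewrite -val_eqE /= ii' shift_blockE => /negbTE->; rewrite mul0r.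
Qed.

Lemma shift_mul_last n (X : 'M[F]_n) (i j : 'I_n) :
  i.+1 = n -> (jordan_block 0 n *m X) i j = 0.
Proof.
move=> iN; rewrite mxE big1 // => k _.
by rewrite shift_blockE iN ltn_eqF ?mul0r.
Qed.

Lemma mul_shift_succ n (X : 'M[F]_n) (i j j' : 'I_n) :
  j' = j.+1 :> nat -> (X *m jordan_block 0 n) i j' = X i j.
Proof.
move=> jj'; rewrite mxE (bigD1 j) //= shift_blockE jj' eqxx mulr1 big1 ?addr0 //.
move=> k; rewrite -val_eqE /= => kj.
by rewrite shift_blockE jj' eqSS eq_sym (negbTE kj) mulr0.
Qed.

Lemma mul_shift_first n (X : 'M[F]_n) (i j : 'I_n) :
  j = 0%N :> nat -> (X *m jordan_block 0 n) i j = 0.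
Proof. by move=> j0; rewrite mxE big1 // => k _; rewrite shift_blockE j0 mulr0. Qed.

Lemma ord_succ_or_last n (i : 'I_n) :
  (exists i' : 'I_n, i' = i.+1 :> nat) \/ i.+1 = n.
Proof.
have := ltn_ord i; rewrite leq_eqVlt => /orP[/eqP|lt_in]; first by right.
by left; exists (Ordinal lt_in).
Qed.

Lemma ord_first_or_succ n (j : 'I_n) :
  j = 0%N :> nat \/ exists j0 : 'I_n, j = j0.+1 :> nat.
Proof.
case: (posnP j) => [|j_gt0]; [by left | right].
have lt_j0 : (j.-1 < n)%N by apply: leq_ltn_trans (leq_pred j) (ltn_ord j).
by exists (Ordinal lt_j0); rewrite /= prednK.
Qed.

(** The entry at [(i, j+1)] is [lam] times the recursion for [Omega] at
    [(i, j)], except below the diagonal and on the border, where every term is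
    a zero of the triangular matrix [Omega]. *)
Lemma Omega_shift lam n (X := Omega lam n) (N := jordan_block 0 n) :
  lam != 0 -> lam^-1 *: (N *m X) + lam *: (X *m N) + N *m X *m N = 0.
Proof.
move=> lam0; apply/matrixP => i j; rewrite [RHS]mxE mxE [Z in Z + _]mxE.
rewrite [Z in Z + _ + _]mxE [Z in _ + Z + _]mxE.
have [j0|[j0 jj0]] := ord_first_or_succ j.
  rewrite !(mul_shift_first _ _ j0) mulr0 !addr0.
  have [[i' ii']|iN] := ord_succ_or_last i; last by rewrite shift_mul_last ?mulr0.
  by rewrite (shift_mul_succ _ _ ii') Omega_lower ?mulr0 // j0 ii'.
rewrite !(mul_shift_succ _ _ jj0).
have [[i' ii']|iN] := ord_succ_or_last i; last first.
  have ltji : (j0 < i)%N by rewrite -ltnS -jj0 iN.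
  by rewrite !shift_mul_last // Omega_lower // !mulr0 !addr0.
rewrite !(shift_mul_succ _ _ ii').
have [leij|ltji] := leqP i j0; last first.
  have lt_j0i' : (j0 < i')%N by rewrite ii' ltnW.
  have lt_ji' : (j < i')%N by rewrite ii' jj0.
  by rewrite /X !Omega_lower // !mulr0 !addr0.
rewrite /X (Omega_rec _ ii' jj0 leij) mulrBr !mulrA mulrN divff //.
by rewrite expr2 invfM mulrA divff // mul1r mulN1r addrCA subrr addr0 addNr.
Qed.

Lemma jordan_Omega_jordan lam n : lam != 0 ->
  jordan_block lam n *m Omega lam n *m jordan_block lam^-1 n = Omega lam n.
Proof.
move=> lam0; have := Omega_shift n lam0.
rewrite (jordan_blockE lam) (jordan_blockE lam^-1).
move: (jordan_block 0 n) (Omega lam n) => N X eq0.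
rewrite !(mulmxDl, mulmxDr) !mul_scalar_mx !mul_mx_scalar scalerA mulVf //.
by rewrite scale1r -!scalemxAl -addrA [Z in _ + Z]addrA eq0 addr0.
Qed.

(** Commuting with the shift makes [B] constant along diagonals, with zeros
    entering from the bottom row, so that its last column determines all the
    others, from right to left. *)
Lemma commute_jordan_eq1 lam n (B : 'M[F]_n) :
  B *m jordan_block lam n = jordan_block lam n *m B ->
  (forall i j : 'I_n, j.+1 = n -> B i j = (i == j)%:R) -> B = 1%:M.
Proof.
rewrite jordan_blockE mulmxDl mulmxDr scalar_mxC => /addrI BN Blast.
suff colB k (i j : 'I_n) : (j + k).+1 = n -> B i j = (i == j)%:R.
  apply/matrixP => i j; rewrite mxE; apply: (colB (n - j.+1)%N).
  by rewrite -addSn subnKC.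
elim: k i j => [|k IHk] i j; first by rewrite addn0; apply: Blast.
rewrite addnS => jk.
have [[j' jj']|jN] := ord_succ_or_last j; last first.
  by have := leq_addr k j.+1; rewrite -ltnS addSn jk jN ltnn.
rewrite -(mul_shift_succ _ _ jj') BN.
have [[i' ii']|iN] := ord_succ_or_last i.
  rewrite (shift_mul_succ _ _ ii') IHk; last by rewrite jj' addSn.
  by rewrite -!val_eqE /= ii' jj' eqSS.
rewrite shift_mul_last //; case: eqP => // ij.
by have := ltn_ord j'; rewrite jj' -ij iN ltnn.
Qed.

Lemma Omega_mulV lam n : lam != 0 -> Omega lam n *m Omega lam^-1 n = 1%:M.
Proof.
move=> lam0; have lamV0 : lam^-1 != 0 by rewrite invr_eq0.
have JXJ := jordan_Omega_jordan n lam0.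
have JYJ := jordan_Omega_jordan n lamV0; rewrite invrK in JYJ.
apply: (@commute_jordan_eq1 lam) => [|i j jn].
  by rewrite -{1}JXJ -!mulmxA [jordan_block lam^-1 n *m _]mulmxA JYJ.
rewrite mxE (bigD1 j) //= !Omega_last_col // eqxx mulr1 big1 ?addr0 //.
by move=> k kj; rewrite (@Omega_last_col _ lam^-1) // (negbTE kj) mulr0.
Qed.

Lemma Omega_unit lam n : lam != 0 -> Omega lam n \in unitmx.
Proof. by move=> /(Omega_mulV n)/mulmx1_unit[]. Qed.

Lemma jordan_block_unit lam n : lam != 0 -> jordan_block lam n \in unitmx.
Proof.
move=> lam0; suff /mulmx1_unit[] : jordan_block lam n *m
  (Omega lam n *m jordan_block lam^-1 n *m Omega lam^-1 n) = 1%:M by [].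
by rewrite !mulmxA jordan_Omega_jordan // Omega_mulV.
Qed.

(** Since [h^-1 = h], the relation [h A h^-1 = A^-1] becomes [A h A = h], which
    mentions no inverse. *)
Lemma involution_reverses n (A h : 'M[F]_n) :
  A \in unitmx -> involution h -> A *m h *m A = h ->
  h \in unitmx /\ h *m A *m invmx h = invmx A.
Proof.
move=> A_unit hh AhA; have [h_unit _] := mulmx1_unit hh; split=> //.
apply: (can_inj (mulKmx A_unit)).
by rewrite mulmxV // !mulmxA AhA mulmxV.
Qed.

End JordanOmega.

Theorem mainTheorem2 (R : realType) (n : nat) (n_ge1 : (1 <= n)%N) :
  (forall mu : R[i], mu = -1 \/ mu = 1 ->
     let J := jordan_block mu n in
     let h := Omega mu n in
     [/\ J \in unitmx, h \in unitmx, involution h &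
         h *m J *m invmx h = invmx J])
  /\
  (forall lam : R[i], lam <> -1 -> lam <> 0 -> lam <> 1 ->
     let A := block_mx (jordan_block lam n) 0 0 (jordan_block lam^-1 n) in
     let h := block_mx 0 (Omega lam n) (invmx (Omega lam n)) 0 in
     [/\ Omega lam n \in unitmx, A \in unitmx, h \in unitmx, involution h &
         h *m A *m invmx h = invmx A]).
Proof.
split=> [mu mu_pm1 J h | lam _ /eqP lam0 _ A h].
  have mu0 : mu != 0 by case: mu_pm1 => ->; rewrite ?oppr_eq0 oner_eq0.
  have muV : mu^-1 = mu by case: mu_pm1 => ->; rewrite ?invrN invr1.
  have J_unit : J \in unitmx by apply: jordan_block_unit.
  have hh : involution h by have := Omega_mulV n mu0; rewrite muV.
  have JhJ : J *m h *m J = h by have := jordan_Omega_jordan n mu0; rewrite muV.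
  by have [] := involution_reverses J_unit hh JhJ.
have lamV0 : lam^-1 != 0 by rewrite invr_eq0.
have X_unit := Omega_unit n lam0.
have JXJ := jordan_Omega_jordan n lam0.
have J_unit := jordan_block_unit n lam0.
have J'_unit := jordan_block_unit n lamV0.
have A_unit : A \in unitmx by rewrite unitmxE det_ublock unitrM -!unitmxE J_unit.
have hh : involution h.
  rewrite /involution mulmx_block !(mul0mx, mulmx0, add0r, addr0) mulmxV // mulVmx //.
  by rewrite -scalar_mx_block.
have AhA : A *m h *m A = h.
  rewrite !mulmx_block !(mul0mx, mulmx0, add0r, addr0) JXJ.
  congr block_mx.
  (* The lower left block is the inverse of the identity for [Omega lam n]. *)
  apply: (can_inj (mulmxK X_unit)); rewrite mulVmx //.
  apply: (can_inj (mulmxK J'_unit)); rewrite mul1mx -!mulmxA.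
  by rewrite [jordan_block lam n *m _]mulmxA JXJ mulVmx // mulmx1.
by have [] := involution_reverses A_unit hh AhA.
Qed.
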